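(* Let $M$ be a simple matroid on $[n]$ of rank $r$, $N$ a matroid of rank $r'$, and $\varphi:M\to N$ a morphism of matroids with $\mathrm{rank}_N(\varphi([n]))=r'$. Then $\partial_0\overline P_\varphi,\partial_1\overline P_\varphi,\dots,\partial_n\overline P_\varphi$ are $\mathbb R$-linearly dependent if and only if at least one of the following holds: (A) $r=r'$; (B) $r-r'=1$ and $|L_\varphi|=1$; (C) $M|_{L_\varphi}$ is a uniform matroid and $|[n]\setminus L_\varphi|=r'$.
   Context: Let $N$ be a matroid on a finite set $E$. A morphism $\varphi:M\to N$ is a map $\varphi:[n]\to E$ such that for all $S_1\subset S_2\subset[n]$, $\mathrm{rank}_N(\varphi(S_2))-\mathrm{rank}_N(\varphi(S_1))\le\mathrm{rank}_M S_2-\mathrm{rank}_M S_1$. A basis of $\varphi$ is an independent set $I$ of $M$ with $\mathrm{rank}_N(\varphi(I))=\mathrm{rank}(N)$; $\mathcal B(\varphi)$ denotes the set of bases of $\varphi$. The basis generating polynomial of $\varphi$ is $P_\varphi=\sum_{I\in\mathcal B(\varphi)}x_0^{n-|I|}\prod_{i\in I}x_i\in\mathbb R[x_0,\dots,x_n]$ and the reduced basis generating polynomial is $\overline P_\varphi=\partial_0^{\,n-r}P_\varphi$, with $\partial_i=\partial/\partial x_i$. An element $i\in[n]$ is a $\varphi$-loop if $\varphi(i)$ is a loop of $N$; $L_\varphi$ is the set of $\varphi$-loops. $M|_{L_\varphi}$ is the restriction of $M$ to $L_\varphi$ (independent sets: independent sets of $M$ contained in $L_\varphi$); a uniform matroid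 on a set $X$ of rank $s$ is one whose bases are all $s$-subsets of $X$. A matroid is simple if it has no loops and no parallel pairs. *)

(* Defs.v *)
From HB Require Import structures.
From mathcomp Require Import all_boot all_order all_algebra reals.
From mathcomp Require Import mpoly.

Set Implicit Arguments.
Unset Strict Implicit.
Unset Printing Implicit Defensive.

Import GRing.Theory.
Local Open Scope ring_scope.

Record matroid (T : finType) := Matroid {
  indep : pred {set T};
  indep0 : indep set0;
  indepS : forall A B : {set T}, A \subset B -> indep B -> indep A;
  indep_aug : forall A B : {set T}, indep A -> indep B -> (#|A| < #|B|)%N ->
    exists2 x, x \in B :\: A & indep (x |: A)
}.

Section MatroidTheory.
Variables (T : finType) (M : matroid T).

Definition rk (S : {set T}) : nat :=
  \max_(I : {set T} | indep M I && (I \subset S)) #|I|.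

Definition mrank : nat := rk [set: T].

Definition is_basis (B : {set T}) : bool := maxset (indep M) B.

Definition is_loop (x : T) : bool := ~~ indep M [set x].

Definition is_parallel (x y : T) : bool :=
  [&& x != y, ~~ is_loop x, ~~ is_loop y & ~~ indep M [set x; y]].

Definition simple_matroid : Prop :=
  (forall x, ~~ is_loop x) /\ (forall x y, ~~ is_parallel x y).

Definition uniform_matroid : Prop :=
  exists s : nat, forall B : {set T}, is_basis B <-> #|B| = s.

End MatroidTheory.

Section Restriction.
Variables (T : finType) (M : matroid T) (X : {set T}).

Local Notation XT := {x : T | x \in X}.

Definition restr_indep : pred {set XT} :=
  fun A => indep M [set val x | x in A].

Lemma restr_indep0 : restr_indep set0.
Proof. by rewrite /restr_indep imset0 indep0. Qed.

Lemma restr_indepS (A B : {set XT}) :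
  A \subset B -> restr_indep B -> restr_indep A.
Proof. by move=> sAB; apply/indepS/imsetS. Qed.

Lemma restr_indep_aug (A B : {set XT}) :
  restr_indep A -> restr_indep B -> (#|A| < #|B|)%N ->
  exists2 x, x \in B :\: A & restr_indep (x |: A).
Proof.
move=> iA iB ltAB.
have [|y] := indep_aug iA iB; first by rewrite !(card_imset _ val_inj).
case/setDP=> /imsetP[x Bx ->]; rewrite (mem_imset _ _ val_inj) => nAx iAx.
exists x; first by rewrite inE nAx.
by rewrite /restr_indep imsetU1.
Qed.

Definition restrict : matroid {x : T | x \in X} :=
  Matroid restr_indep0 restr_indepS restr_indep_aug.

End Restriction.

(* [rk] is monotone, so the truncated subtractions are exact. *)
Definition matroid_morphism (T E : finType) (M : matroid T) (N : matroid E)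
    (phi : T -> E) : Prop :=
  forall S1 S2 : {set T}, S1 \subset S2 ->
    (rk N (phi @: S2) - rk N (phi @: S1) <= rk M S2 - rk M S1)%N.

Definition morphism_bases (T E : finType) (M : matroid T) (N : matroid E)
    (phi : T -> E) : {set {set T}} :=
  [set I : {set T} | indep M I && (rk N (phi @: I) == mrank N)].

Definition morphism_loops (T E : finType) (N : matroid E) (phi : T -> E) :
    {set T} :=
  [set i | is_loop N (phi i)].

(* The ground set [n] is 'I_n, and the variables x_0, ..., x_n are indexed by
   'I_n.+1: x_0 is 'X_ord0, and element i : 'I_n has variable
   'X_(lift ord0 i). *)
Section BasisGeneratingPolynomial.
Variables (R : realType) (n : nat) (E : finType).
Variables (M : matroid 'I_n) (N : matroid E) (phi : 'I_n -> E).

Definition basis_gen_poly : {mpoly R[n.+1]} :=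
  \sum_(I in morphism_bases M N phi)
    'X_ord0 ^+ (n - #|I|) * \prod_(i in I) 'X_(lift ord0 i).

Definition reduced_basis_gen_poly : {mpoly R[n.+1]} :=
  basis_gen_poly^`M(ord0, (n - mrank M)%N).

End BasisGeneratingPolynomial.

(* {mpoly R[n]} is not a vectType, so [free] does not apply to it. *)
Definition lin_dependent (R : nzRingType) (V : lmodType R) (I : finType)
    (v : I -> V) : Prop :=
  exists c : I -> R, (exists i, c i != 0) /\ \sum_i c i *: v i = 0.

(* Main.v *)
(* Taking the coefficient of x_0^(r-1-|J|) x^J turns a linear relation among the
   partial derivatives into: for every J with |J| < r,
     a_0 (n - |J|) [J in B] + sum of the a_i with i outside J and J+i in B = 0.
   Replace N by its pullback to [n], a quotient of M. For an independent set J
   let out(J) be the sum of the a_i over the i outside the closure of J; these i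
   are partitioned by the flats covering cl(J), and the class of i contributes
   out(J) - out(J+i). For |J| = r'-1 the relations give out_N(J) = 0, and downward
   induction along this partition extends this to all N-independent J. The same
   induction in the simple matroid M shows that a_0 = 0 forces a = 0, so one may
   take a_0 = -1, whence out_M(J) = n - |J| for J in B with |J| < r.
   If r - r' >= 2, each class at J in B with |J| <= r-2 has sum 1 while the total is
   n - |J|, so all classes are singletons; this yields (C). If r - r' = 1, downward
   induction gives out_M(J) = n - r' for all N-independent J; comparing with
   out_N(J) at J = 0 produces a loop, which is unique because M is simple. *)
Require Import Defs.
From mathcomp Require Import all_boot all_order all_algebra reals.
From mathcomp Require Import mpoly.
From mathcomp Require Import zify.

Set Implicit Arguments.
Unset Strict Implicit.
Unset Printing Implicit Defensive.

Import Order.TTheory GRing.Theory Num.Theory.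
Local Open Scope ring_scope.

(** * Exponents of monomials and coefficients of iterated derivatives *)

Lemma mcoeff_derivn (R : nzRingType) (n k : nat) (i : 'I_n) (p : {mpoly R[n]})
    (m : 'X_{1..n}) :
  p^`M(i, k)@_m = p@_(m + U_(i) *+ k) *+ (m i + k) ^_ k.
Proof.
elim: k m => [|k IHk] m; first by rewrite mderivn0 mulm0n addm0 ffactn0.
rewrite mderivnS mcoeff_deriv IHk -addmA -mulmS -mulrnA mnmDE mnm1E eqxx.
by rewrite addn1 addnS ffactnSr subSn ?leq_addl // addnK.
Qed.

(** The exponent vector of x_0^k x^J. *)
Definition set_mnm (n k : nat) (J : {set 'I_n}) : 'X_{1..n.+1} :=
  [multinom if unlift ord0 i is Some j then nat_of_bool (j \in J) else k
  | i < n.+1].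

Lemma set_mnm0 (n k : nat) (J : {set 'I_n}) : set_mnm k J ord0 = k.
Proof. by rewrite mnmE unlift_none. Qed.

Lemma set_mnm_lift (n k : nat) (J : {set 'I_n}) (i : 'I_n) :
  set_mnm k J (lift ord0 i) = (i \in J).
Proof. by rewrite mnmE liftK. Qed.

Lemma mnm_liftP (n : nat) (m m' : 'X_{1..n.+1}) :
  m ord0 = m' ord0 -> (forall i, m (lift ord0 i) = m' (lift ord0 i)) -> m = m'.
Proof. by move=> e0 eS; apply/mnmP=> i; case: (unliftP ord0 i) => [j|] ->. Qed.

Lemma set_mnm_inj (n k k' : nat) (J J' : {set 'I_n}) :
  (set_mnm k J == set_mnm k' J') = (k == k') && (J == J').
Proof.
apply/eqP/andP=> [/mnmP e|[/eqP-> /eqP->] //]; split; apply/eqP.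
  by have := e ord0; rewrite !set_mnm0.
apply/setP=> i; have := e (lift ord0 i); rewrite !set_mnm_lift.
by case: (i \in J); case: (i \in J').
Qed.

Lemma mnm_is_set (n : nat) (m : 'X_{1..n.+1}) :
    (forall i, m (lift ord0 i) <= 1)%N ->
  m = set_mnm (m ord0) [set i | m (lift ord0 i) == 1%N].
Proof.
move=> m_le1; apply: mnm_liftP => [|i]; first by rewrite set_mnm0.
by rewrite set_mnm_lift inE; case: (m _) (m_le1 i) => [|[]].
Qed.

Lemma addmU0_set_mnm (n k l : nat) (J : {set 'I_n}) :
  (set_mnm k J + U_(ord0) *+ l)%MM = set_mnm (k + l) J.
Proof.
apply: mnm_liftP => [|i]; rewrite mnmDE mulmnE mnm1E.
  by rewrite eqxx mul1n !set_mnm0.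
by rewrite !set_mnm_lift mul0n addn0.
Qed.

Lemma addmU_set_mnm (n k : nat) (J : {set 'I_n}) (i : 'I_n) : i \notin J ->
  (set_mnm k J + U_(lift ord0 i))%MM = set_mnm k (i |: J).
Proof.
move=> nJi; apply: mnm_liftP => [|j]; rewrite mnmDE mnm1E.
  by rewrite !set_mnm0 addn0.
rewrite !set_mnm_lift !inE (inj_eq (lift_inj (h:=ord0))) eq_sym.
by case: eqVneq => [->|]; rewrite ?(negPf nJi) ?addn0.
Qed.

(** * From linear dependence of polynomials to relations indexed by sets *)

Section Coefficients.
Variables (R : realType) (n : nat) (E : finType).
Variables (M : matroid 'I_n) (N : matroid E) (phi : 'I_n -> E).
Local Notation B := (morphism_bases M N phi).
Local Notation P := (basis_gen_poly R M N phi).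

Lemma basis_gen_polyE : P = \sum_(I in B) 'X_[set_mnm (n - #|I|) I].
Proof.
apply: eq_bigr => I _; rewrite mprodXE mpolyXn -mpolyXD; congr 'X_[_].
apply: mnm_liftP => [|i]; rewrite mnmDE mulmnE mnm1E mnm_sumE.
  by rewrite eqxx mul1n set_mnm0 big1 ?addn0 // => i _; rewrite mnm1E.
rewrite mul0n add0n set_mnm_lift.
under eq_bigr => j do rewrite mnm1E (inj_eq (lift_inj (h:=ord0))).
have [Ii|nIi] := boolP (i \in I).
  rewrite (bigD1 i) //= eqxx big1 ?addn0 // => j /andP[_ /negPf->] //.
by rewrite big1 // => j Ij; case: eqP => // eji; rewrite -eji Ij in nIi.
Qed.

Lemma mcoeff_basis_gen_poly (k : nat) (J : {set 'I_n}) :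
  P@_(set_mnm k J) = ((J \in B) && (k == n - #|J|)%N)%:R.
Proof.
rewrite basis_gen_polyE raddf_sum /=.
under eq_bigr => I _ do rewrite mcoeffX set_mnm_inj.
have [BJ|nBJ] := boolP (J \in B); last first.
  rewrite big1 // => I BI; case: (I =P J) => [eIJ|]; last by rewrite andbF.
  by rewrite -eIJ BI in nBJ.
rewrite (bigD1 J) //= eqxx andbT big1 ?addr0 ?[k == _]eq_sym //.
by move=> I /andP[_ /negPf->]; rewrite andbF.
Qed.

Lemma mcoeff_basis_gen_poly_eq0 (m : 'X_{1..n.+1}) (i : 'I_n) :
  (1 < m (lift ord0 i))%N -> P@_m = 0.
Proof.
move=> m_gt1; rewrite basis_gen_polyE raddf_sum /= big1 // => I _.
rewrite mcoeffX; case: eqP => // em; move: m_gt1.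
by rewrite -em set_mnm_lift; case: (i \in I).
Qed.

(* After division by [(n - #|J| - 1)! / (r - #|J| - 1)!], the coefficient of
   [x_0 ^ (r - 1 - #|J|) * x ^ J] in [\sum_i a_i \partial_i]. *)
Definition dependence_relation (a0 : R) (a : 'I_n -> R) : Prop :=
  forall J : {set 'I_n}, (#|J| < mrank M)%N ->
    a0 * (n - #|J|)%:R * (J \in B)%:R
      + \sum_(i | (i \notin J) && (i |: J \in B)) a i = 0.

Lemma mrank_le : (mrank M <= n)%N.
Proof.
apply/bigmax_leqP => I _; rewrite -[leqRHS](card_ord n); exact: max_card.
Qed.

(** [P] is homogeneous of degree n and squarefree in the element variables, so a combination of the
    derivatives is determined by its coefficients at x_0^k x^J with k + |J| + 1 = r. Each of these
    is the relation at [J] times a positive falling factorial, which cancels in characteristic 0. *)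
Lemma lin_dependentP :
  lin_dependent (fun i : 'I_n.+1 => (reduced_basis_gen_poly R M N phi)^`M(i)) <->
  exists a0 a, (a0 != 0 \/ exists i, a i != 0) /\ dependence_relation a0 a.
Proof.
have le_rn := mrank_le; set r := mrank M in le_rn *.
pose D (c : 'I_n.+1 -> R) :=
  \sum_i c i *: (reduced_basis_gen_poly R M N phi)^`M(i).
have DE c m : (D c)@_m =
    c ord0 * P@_(m + U_(ord0) *+ (n - r).+1)
      *+ ((m ord0 + (n - r).+1) ^_ (n - r)) *+ (m ord0).+1 +
    \sum_i c (lift ord0 i) * P@_(m + U_(lift ord0 i) + U_(ord0) *+ (n - r))
      *+ ((m ord0 + (n - r)) ^_ (n - r)) *+ (m (lift ord0 i)).+1.
  rewrite raddf_sum /= big_ord_recl; congr (_ + _).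
    rewrite mcoeffZ mcoeff_deriv mcoeff_derivn -addmA -mulmS mnmDE mnm1E eqxx.
    by rewrite addn1 addnS -!mulrnAr.
  apply: eq_bigr => i _; rewrite mcoeffZ mcoeff_deriv mcoeff_derivn.
  by rewrite mnmDE mnm1E addn0 -!mulrnAr.
have D0 c (m : 'X_{1..n.+1}) (i : 'I_n) : (1 < m (lift ord0 i))%N -> (D c)@_m = 0.
  move=> m_gt1; rewrite DE.
  rewrite [P@__](@mcoeff_basis_gen_poly_eq0 _ i) ?mulr0 ?mul0rn ?add0r; last first.
    by rewrite !mnmDE; lia.
  rewrite big1 // => j _; rewrite (@mcoeff_basis_gen_poly_eq0 _ i) ?mulr0 ?mul0rn //.
  by rewrite !mnmDE; lia.
have DS c k J : (D c)@_(set_mnm k J) =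
    if (k + #|J|).+1 == r then
      (c ord0 * (n - #|J|)%:R * (J \in B)%:R +
        \sum_(i | (i \notin J) && (i |: J \in B)) c (lift ord0 i))
      *+ ((k + (n - r)) ^_ (n - r))
    else 0.
  have leJ : (#|J| <= n)%N by rewrite -[leqRHS](card_ord n); exact: max_card.
  rewrite DE set_mnm0 addmU0_set_mnm mcoeff_basis_gen_poly.
  move ej: #|J| leJ => j leJ.
  rewrite [X in _ + X](_ : _ =
    \sum_(i | (i \notin J) && (i |: J \in B))
      (c (lift ord0 i) * ((k + j).+1 == r)%:R) *+ (k + (n - r)) ^_ (n - r)); last first.
    rewrite [RHS]big_mkcond /=; apply: eq_bigr => i _.
    have [Ji|nJi] /= := boolP (i \in J).
      (* Here the exponent of x_i would be 2, and [P] is squarefree in x_i. *)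
      rewrite (@mcoeff_basis_gen_poly_eq0 _ i) ?mulr0 ?mul0rn //.
      by rewrite !mnmDE mnm1E set_mnm_lift Ji eqxx; lia.
    rewrite addmU_set_mnm // addmU0_set_mnm mcoeff_basis_gen_poly set_mnm_lift.
    rewrite (negPf nJi) mulr1n; case: ifP => [BiJ|]; last by rewrite mulr0 mul0rn.
    have ciJ : #|i |: J| = j.+1 by rewrite cardsU1 nJi ej.
    have: (#|i |: J| <= n)%N by rewrite -[leqRHS](card_ord n); exact: max_card.
    rewrite ciJ andTb => ltJ; congr (_ * (nat_of_bool _)%:R *+ _).
    by clear -ltJ le_rn; clearbody r; apply/eqP/eqP; lia.
  have -> : (k + (n - r).+1 == n - j)%N = ((k + j).+1 == r).
    by clear -leJ le_rn; clearbody r; apply/eqP/eqP; lia.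
  case: eqP => [ekJ|nekJ]; last first.
    rewrite andbF mulr0 !mul0rn add0r.
    by rewrite big1 // => i _; rewrite mulr0 mul0rn.
  rewrite mulrnDl -sumrMnl; congr (_ + _); last by under eq_bigr do rewrite mulr1.
  rewrite andbT.
  case: (J \in B); rewrite ?mulr0 ?mul0rn // !mulr1 mulr_natr -!mulrnA.
  (* Since n - j = k + (n - r) + 1, both multiplicities equal the falling factorial of n - j of
     length n - r + 1: one side splits off its first factor n - j, the other its last factor k +
     1. *)
  congr (_ *+ _); rewrite [LHS](_ : _ = ((n - j) ^_ (n - r).+1)%N).
    by rewrite ffactnS; congr (_ * _ ^_ _)%N; lia.
  by rewrite ffactnSr; congr (_ ^_ _ * _)%N; lia.
split=> [[c [c_neq0 c_dep]]|[a0 [a [a_neq0 a_dep]]]].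
  exists (c ord0), (fun i => c (lift ord0 i)); split.
    case: c_neq0 => i; case: (unliftP ord0 i) => [j|] ->; last by left.
    by right; exists j.
  move=> J ltJr; have := DS c (r - #|J|.+1)%N J.
  rewrite /D c_dep mcoeff0 (_ : _ == r); last by lia.
  move/esym/eqP; rewrite mulrn_eq0 => /orP[|/eqP//].
  by rewrite -leqn0 leqNgt ffact_gt0; lia.
pose c i := if unlift ord0 i is Some j then a j else a0.
have cS i : c (lift ord0 i) = a i by rewrite /c liftK.
have c0 : c ord0 = a0 by rewrite /c unlift_none.
exists c; split.
  case: a_neq0 => [|[i]]; first by exists ord0; rewrite c0.
  by exists (lift ord0 i); rewrite cS.
apply/mpolyP=> m; rewrite mcoeff0 -/(D c).
have [/existsP[i /D0->//]|] := boolP [exists i, 1 < m (lift ord0 i)]%N.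
rewrite negb_exists => /forallP m_le1.
rewrite [m]mnm_is_set => [|i]; last by rewrite leqNgt.
rewrite DS; case: eqP => // ekJ; rewrite c0.
under eq_bigr do rewrite cS.
by rewrite a_dep ?mul0rn //; lia.
Qed.

End Coefficients.

(** * Rank, independence and loops in a matroid *)

Lemma superset_card (T : finType) (A : {set T}) (k : nat) :
  (#|A| <= k <= #|T|)%N -> exists2 C : {set T}, A \subset C & #|C| = k.
Proof.
case/andP=> leAk lekT; have [d ed] : exists d, d = (k - #|A|)%N by exists (k - #|A|)%N.
elim: d => [|d IHd] in A leAk ed *; first by exists A => //; lia.
have [x nAx] : exists x, x \in ~: A.
  by apply/set0Pn; rewrite -card_gt0; have := cardsC A; lia.
rewrite inE in nAx; have cA := cardsU1 x A; rewrite nAx /= in cA.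
have [||C sC cC] := IHd (x |: A); [lia..|].
by exists C => //; apply: subset_trans sC; exact: subsetUr.
Qed.

Section Rank.
Variables (T : finType) (M : matroid T).
Implicit Types (A I J S : {set T}).

Lemma rk_witness S : exists I, [/\ indep M I, I \subset S & #|I| = rk M S].
Proof.
rewrite /rk; have [|I /andP[iI sIS] ->] :=
  @eq_bigmax_cond _ [pred I : {set T} | indep M I && (I \subset S)] (fun I => #|I|).
  by rewrite (cardD1 set0) !inE /= indep0 sub0set.
by exists I.
Qed.

Lemma card_le_rk I S : indep M I -> I \subset S -> (#|I| <= rk M S)%N.
Proof. by move=> iI sIS; apply: leq_bigmax_cond; rewrite iI. Qed.

Lemma rk_le_card S : (rk M S <= #|S|)%N.
Proof. by have [I [_ /subset_leq_card sIS <-]] := rk_witness S. Qed.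

Lemma rkS A S : A \subset S -> (rk M A <= rk M S)%N.
Proof.
move=> sAS; have [I [iI sIA <-]] := rk_witness A.
exact/card_le_rk/(subset_trans sIA).
Qed.

Lemma rk_le_mrank S : (rk M S <= mrank M)%N.
Proof. exact/rkS/subsetT. Qed.

Lemma rk_indep I : indep M I -> rk M I = #|I|.
Proof. by move=> iI; apply/eqP; rewrite eqn_leq rk_le_card card_le_rk. Qed.

Lemma rk_set0 : rk M set0 = 0%N.
Proof. by rewrite rk_indep ?indep0 ?cards0. Qed.

Lemma card_indep_le I : indep M I -> (#|I| <= mrank M)%N.
Proof. by move=> iI; rewrite -rk_indep ?rk_le_mrank. Qed.

Lemma indep_rk S : (#|S| <= rk M S)%N -> indep M S.
Proof.
move=> leS; have [I [iI sIS cI]] := rk_witness S.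
by have /eqP<- : I == S by rewrite eqEcard sIS cI.
Qed.

Lemma indep_loopN I x : indep M I -> x \in I -> ~~ is_loop M x.
Proof. by move=> iI Ix; rewrite negbK; apply: indepS iI; rewrite sub1set. Qed.

Lemma indep_disjoint_loops I (L : {set T}) :
  indep M I -> (forall x, x \in L -> is_loop M x) -> [disjoint I & L].
Proof.
move=> iI loopL; apply/pred0P=> x /=; apply/negP=> /andP[Ix /loopL].
exact/negP/(indep_loopN iI Ix).
Qed.

Lemma rkU_loops S (L : {set T}) :
  (forall x, x \in L -> is_loop M x) -> rk M (S :|: L) = rk M S.
Proof.
move=> loopL; apply/eqP; rewrite eqn_leq [X in _ && X]rkS ?subsetUl // andbT.
have [I [iI sI <-]] := rk_witness (S :|: L); apply: card_le_rk => //.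
apply/subsetP=> x Ix; have := subsetP sI x Ix; rewrite inE => /orP[//|/loopL].
by rewrite (negPf (indep_loopN iI Ix)).
Qed.

End Rank.

(** * Elements outside the closure of a set, partitioned by covering flats *)

Section Extensions.
Variables (T : finType) (M : matroid T).
Implicit Types (J S : {set T}) (i j k : T).

(** For independent [J], this is the complement of the closure of [J]. *)
Definition extensions J : {set T} := [set i | (i \notin J) && indep M (i |: J)].
Local Notation ext := extensions.

(* For independent [J] and [i] outside the closure of [J], this is
   [cl (i |: J) :\: cl J]. *)
Definition ext_class J i : {set T} := ext J :\: ext (i |: J).
Local Notation cls := ext_class.

Lemma subset_ext J i : ext (i |: J) \subset ext J.
Proof.
apply/subsetP=> j; rewrite !inE negb_or => /andP[/andP[_ ->] /=].
by apply: indepS; rewrite setUS ?subsetUr.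
Qed.

Lemma mem_ext2 J i j : i \in ext J ->
  (j \in ext (i |: J)) = [&& j != i, j \notin J & indep M (j |: (i |: J))].
Proof. by rewrite !inE negb_or andbA. Qed.

Lemma ext_sym J i j : i \in ext J -> j \in ext J ->
  (j \in ext (i |: J)) = (i \in ext (j |: J)).
Proof.
move=> Ji Jj; rewrite !mem_ext2 // setUCA eq_sym.
by move: Ji Jj; rewrite !inE => /andP[-> _] /andP[-> _].
Qed.

(** Transitivity of being parallel over [J], in contrapositive form: augmenting J + j from the
    larger independent set J + i + k adds either [k] or [i], which gives the two alternatives. *)
Lemma ext_cotrans J i j k : i \in ext J -> j \in ext J -> k \in ext (i |: J) ->
  (j \in ext (i |: J)) || (k \in ext (j |: J)).
Proof.
move=> Ji Jj; rewrite mem_ext2 // => /and3P[nki nJk iki].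
have [->|neji] := eqVneq j i; first by rewrite [k \in _]mem_ext2 // nki nJk iki orbT.
have [->|nejk] := eqVneq j k; first by rewrite mem_ext2 // nki nJk iki.
have [/setIdP[nJi _] /setIdP[nJj iJj]] := (Ji, Jj).
have [|x /setDP[/setU1P[->|/setU1P[->|Jx]] nx] ix] := indep_aug iJj iki.
- by rewrite !cardsU1 nJj nJi !inE negb_or nki nJk.
- by rewrite orbC mem_ext2 // eq_sym nejk nJk ix.
- by rewrite mem_ext2 // setUCA ix neji nJj.
- by rewrite !inE Jx orbT in nx.
Qed.

(** Being parallel over [J] is an equivalence relation on [ext J], by [ext_sym] and [ext_cotrans];
    hence the classes partition [ext J]. *)
Lemma eq_ext_class J i j : i \in ext J -> j \in ext J ->
  (cls J j == cls J i) = (j \in cls J i).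
Proof.
move=> Ji Jj; apply/eqP/idP=> [<-|].
  by rewrite inE Jj andbT mem_ext2 // eqxx.
rewrite in_setD Jj andbT => nij; apply/setP=> k; rewrite !in_setD.
case Jk: (k \in ext J); rewrite ?andbF ?andbT //; congr (~~ _).
apply/idP/idP=> [/(ext_cotrans Jj Ji)|/(ext_cotrans Ji Jj)].
  by rewrite ext_sym // (negPf nij).
by rewrite (negPf nij).
Qed.

Lemma extensions_neq0 J : indep M J -> (#|J| < mrank M)%N -> exists i, i \in ext J.
Proof.
move=> iJ; have [I [iI _ cI]] := rk_witness M [set: T]; rewrite /mrank -cI => ltJI.
have [x] := indep_aug iJ iI ltJI; rewrite inE => /andP[nJx _] ixJ.
by exists x; rewrite inE nJx.
Qed.

Lemma indep_ext J i : i \in ext J -> indep M (i |: J).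
Proof. by rewrite inE => /andP[]. Qed.

Lemma card_ext J i : i \in ext J -> #|i |: J| = #|J|.+1.
Proof. by rewrite inE cardsU1 => /andP[->]. Qed.

Variables (R : numDomainType) (a : T -> R).

Lemma sum_ext_class J i : i \in ext J ->
  \sum_(j in cls J i) a j = \sum_(j in ext J) a j - \sum_(j in ext (i |: J)) a j.
Proof.
move=> Ji; rewrite [\sum_(j in ext J) _](big_setID (ext (i |: J))) /=.
by rewrite (setIidPr (subset_ext J i)) addrAC subrr add0r.
Qed.

Lemma sum_ext_classes J S (d : R) : S \subset ext J ->
    (forall i, i \in S -> cls J i \subset S) ->
    (forall i, i \in S -> \sum_(j in cls J i) a j = d) ->
  \sum_(i in S) a i = d *+ #|cls J @: S|.
Proof.
move=> sSJ clsS sumS; rewrite (partition_big_imset (cls J)) /=.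
rewrite -sumr_const; apply: eq_bigr => _ /imsetP[i Si ->].
rewrite -(sumS i Si); apply: eq_bigl => j; have Ji := subsetP sSJ i Si.
apply/andP/idP=> [[Sj]|clsj]; first by rewrite eq_ext_class // (subsetP sSJ).
have Sj := subsetP (clsS i Si) j clsj.
by rewrite eq_ext_class // (subsetP sSJ).
Qed.

(** Downward induction on |J|: once the sum vanishes at every J + i, each class at [J] has the same
    sum as the whole of [ext J]. With at least two classes this forces the sum to be 0. *)
Lemma sum_extensions_eq0 :
    (forall J, indep M J -> #|J|.+1 = mrank M -> \sum_(i in ext J) a i = 0) ->
  forall J, indep M J -> \sum_(i in ext J) a i = 0.
Proof.
move=> hyp J; have [k] := ubnP (mrank M - #|J|)%N; elim: k J => // k IHk J ltk iJ.
have leJ := card_indep_le iJ.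
have [geJ|ltJ] := leqP (mrank M) #|J|.
  rewrite big1 // => i Ji; have := card_indep_le (indep_ext Ji).
  by rewrite (card_ext Ji); lia.
have [/hyp->//|neJ] := eqVneq #|J|.+1 (mrank M).
have [i Ji] := extensions_neq0 iJ ltJ.
have [|j ij] := extensions_neq0 (indep_ext Ji); first by rewrite (card_ext Ji); lia.
have Jj := subsetP (subset_ext J i) j ij.
have := @sum_ext_classes J (ext J) (\sum_(i in ext J) a i) (subxx _).
(* [j] lies outside the closure of J + i, so [i] and [j] are in different classes. *)
have gt1 : (1 < #|cls J @: ext J|)%N.
  rewrite (cardD1 (cls J i)) (cardD1 (cls J j)) !inE eq_ext_class // in_setD ij /=.
  by rewrite !imset_f.
have clsS i' : i' \in ext J -> cls J i' \subset ext J by rewrite subDset subsetUr.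
have clsE i' : i' \in ext J -> \sum_(j in cls J i') a j = \sum_(i in ext J) a i.
  move=> Ji'; rewrite sum_ext_class // [X in _ - X]IHk ?subr0 //;
    last exact: indep_ext Ji'.
  by rewrite (card_ext Ji'); lia.
move=> /(_ clsS clsE)/eqP; case: #|_| gt1 => [|[|t]] // _.
rewrite mulrS -subr_eq0 opprD addNKr oppr_eq0 mulrn_eq0 => /eqP//.
Qed.

(** Without loops or parallel pairs, [ext set0] is the whole ground set and [ext [set i]] misses
    only [i]; the two sums differ by [a i]. *)
Lemma simple_sum_extensions_eq0 : simple_matroid M ->
    (forall J, indep M J -> \sum_(i in ext J) a i = 0) -> forall i, a i = 0.
Proof.
move=> [loopM parM] out0 i; have i1 j : indep M [set j] by have := loopM j; rewrite negbK.
have := out0 _ (indep0 M); rewrite (bigD1 i) /=; last by rewrite inE in_set0 setU0 i1.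
rewrite (eq_bigl (mem (ext [set i]))) ?out0 ?addr0 // => j.
rewrite !inE setU0 i1 /=; have [//|neji] /= := eqVneq j i.
by apply/esym; have := parM j i; rewrite /is_parallel neji !loopM negbK.
Qed.

End Extensions.

(** * Uniform matroids described by their independent sets *)

Lemma indep_sub_basis (T : finType) (M : matroid T) (I : {set T}) :
  indep M I -> exists2 B, is_basis M B & I \subset B.
Proof. by move=> iI; have [B] := maxset_exists iI; exists B. Qed.

(** The bound on [s] makes it the actual rank: a set smaller than [s] still has an element outside
    it and so is not maximal. *)
Lemma uniform_matroidP (T : finType) (M : matroid T) :
  uniform_matroid M <->
  exists2 s, (s <= #|T|)%N & forall A, indep M A = (#|A| <= s)%N.
Proof.
split=> [[s basisE]|[s les indepE]].
  have [B /basisE cB _] := indep_sub_basis (indep0 M).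
  exists s => [|A]; first by rewrite -cB max_card.
  apply/idP/idP=> [/indep_sub_basis[C /basisE<- /subset_leq_card//]|leA].
  have [|C sAC cC] := @superset_card _ A s; first by rewrite leA -cB max_card.
  by have /basisE/maxsetp/(indepS sAC) := cC.
exists s => B; split=> [/maxsetP[]|cB]; last first.
  apply/maxsetP; split; first by rewrite indepE cB.
  by move=> C; rewrite indepE => leC sBC; apply/eqP; rewrite eq_sym eqEcard sBC cB.
rewrite indepE => leB maxB; apply/eqP; rewrite eqn_leq leB leqNgt /=.
apply/negP=> ltB; have [x nBx] : exists x, x \in ~: B.
  by apply/set0Pn; rewrite -card_gt0; have := cardsC B; lia.
rewrite inE in nBx; have := maxB (x |: B); rewrite indepE cardsU1 nBx.
by move=> /(_ ltB (subsetUr _ _)) eB; rewrite -eB setU11 in nBx.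
Qed.

Lemma uniform_restrictP (T : finType) (M : matroid T) (X : {set T}) :
  uniform_matroid (restrict M X) <->
  exists2 s, (s <= #|X|)%N & forall A : {set T}, A \subset X -> indep M A = (#|A| <= s)%N.
Proof.
have cX : #|{: {x : T | x \in X}}| = #|X| by rewrite card_sig; apply: eq_card.
rewrite uniform_matroidP cX; split=> -[s les indepE]; exists s => // A.
  move=> sAX; have eA : A = [set val x | x in [set x : {x | x \in X} | val x \in A]].
    apply/setP=> x; apply/idP/imsetP=> [Ax|[y]]; last by rewrite inE => ? ->.
    by exists (exist _ x (subsetP sAX x Ax)); rewrite ?inE.
  by rewrite {2}eA (card_imset _ val_inj) -indepE {1}eA.
rewrite -(card_imset _ val_inj) -indepE //.
by apply/subsetP=> _ /imsetP[x _ ->]; exact: valP.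
Qed.

(** * Pullback of a matroid along a map *)

Section Comap.
Variables (T E : finType) (N : matroid E) (phi : T -> E).

(** The cardinality test says that [phi] is injective on [A], so two elements with the same image
    are never independent together. *)
Definition comap_indep : pred {set T} :=
  fun A => indep N (phi @: A) && (#|phi @: A| == #|A|).

Lemma comap_indep0 : comap_indep set0.
Proof. by rewrite /comap_indep imset0 indep0 !cards0. Qed.

Lemma comap_indepS (A B : {set T}) : A \subset B -> comap_indep B -> comap_indep A.
Proof.
move=> sAB /andP[iB /imset_injP injB]; apply/andP; split.
  exact: indepS (imsetS _ sAB) iB.
by apply/imset_injP=> x y Ax Ay; apply: injB; exact: (subsetP sAB).
Qed.

Lemma comap_indep_aug (A B : {set T}) :
  comap_indep A -> comap_indep B -> (#|A| < #|B|)%N ->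
  exists2 x, x \in B :\: A & comap_indep (x |: A).
Proof.
case/andP=> iA /eqP cA /andP[iB /eqP cB]; rewrite -cA -cB => ltAB.
have [_ /setDP[/imsetP[x Bx ->] nAx] ix] := indep_aug iA iB ltAB.
have nx : x \notin A by apply: contra nAx; exact: imset_f.
exists x; first by rewrite inE nx.
by rewrite /comap_indep imsetU1 ix !cardsU1 nx nAx cA eqxx.
Qed.

Definition comap : matroid T :=
  Matroid comap_indep0 comap_indepS comap_indep_aug.

Lemma imset_section (S : {set T}) (I : {set E}) : I \subset phi @: S ->
  exists A : {set T}, [/\ A \subset S, phi @: A = I & #|A| = #|I|].
Proof.
(* [g] chooses one preimage in [S] for each point, and [A] keeps the chosen preimages of the points
   of [I]. *)
move=> sI; pose g y := [pick x in S | phi x == y].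
pose A := [set x in S | (phi x \in I) && (g (phi x) == Some x)].
have eA : phi @: A = I.
  apply/setP=> y; apply/imsetP/idP=> [[x]|Iy]; first by rewrite !inE => /and3P[_ ? _] ->.
  have /imsetP[x Sx ey] := subsetP sI y Iy.
  have [x' gy [Sx' ey']] : exists2 x', g y = Some x' & x' \in S /\ phi x' = y.
    rewrite /g; case: pickP => [x' /andP[Sx' /eqP ey']|/(_ x)]; first by exists x'.
    by rewrite Sx -ey eqxx.
  by exists x'; rewrite // !inE Sx' ey' Iy gy eqxx.
exists A; split=> //; first by apply/subsetP=> x; rewrite inE => /andP[].
rewrite -eA card_in_imset // => x y; rewrite !inE.
move=> /and3P[_ _ /eqP gx] /and3P[_ _ /eqP gy].
by move=> exy; move: gx; rewrite exy gy => -[].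
Qed.

Lemma rk_comap (S : {set T}) : rk comap S = rk N (phi @: S).
Proof.
apply/eqP; rewrite eqn_leq; apply/andP; split.
  have [I [/andP[iI /eqP<-] sIS <-]] := rk_witness comap S.
  exact/card_le_rk/imsetS.
have [I [iI /imset_section[A [sAS eA cA]] <-]] := rk_witness N (phi @: S).
by rewrite -cA; apply: card_le_rk => //; rewrite /= /comap_indep eA iI cA eqxx.
Qed.

Lemma is_loop_comap (x : T) : is_loop comap x = is_loop N (phi x).
Proof. by rewrite /is_loop /= /comap_indep imset_set1 !cards1 eqxx andbT. Qed.

End Comap.

(** * Matroid quotients on a common ground set, and sufficiency of the three conditions *)

Section Quotient.
Variables (T : finType) (M N : matroid T).
Hypothesis quotMN : matroid_morphism M N id.
Local Notation r := (mrank M).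
Local Notation r' := (mrank N).
Local Notation L := [set i | is_loop N i].
Implicit Types (I J S A : {set T}) (i j : T).

Lemma quot_rk S1 S2 : S1 \subset S2 -> (rk N S2 + rk M S1 <= rk M S2 + rk N S1)%N.
Proof.
move=> sS; have := quotMN sS; rewrite !imset_id.
by have := rkS M sS; have := rkS N sS; lia.
Qed.

Lemma quot_indep J : indep N J -> indep M J.
Proof.
move=> iJ; apply: indep_rk; have := quot_rk (sub0set J).
by rewrite !rk_set0 (rk_indep iJ); lia.
Qed.

Lemma quot_mrank : (r' <= r)%N.
Proof. by have := quot_rk (sub0set [set: T]); rewrite !rk_set0 /mrank; lia. Qed.

(** Going from [A] to its union with [J] raises the N-rank from 0 to |J|, so the quotient inequality
    raises the M-rank from |A| by at least |J|. *)
Lemma indep_setU_loops J A : A \subset L -> indep N J -> indep M A -> indep M (J :|: A).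
Proof.
move=> sAL iJ iA; apply: indep_rk; have := quot_rk (subsetUr J A).
have loopA x : x \in A -> is_loop N x by move=> /(subsetP sAL); rewrite inE.
have rA : rk N A = 0%N by rewrite -(set0U A) rkU_loops // rk_set0.
rewrite rkU_loops // rA (rk_indep iJ) (rk_indep iA).
by rewrite cardsU; lia.
Qed.

(** The bases of the identity morphism from [M] to its quotient [N]. *)
Definition spanning_indep J := indep M J && (rk N J == r').
Local Notation B := spanning_indep.

Lemma spanning_indep_basis I : indep M I -> #|I| = r -> B I.
Proof.
move=> iI cI; rewrite /B iI /=; have := quot_rk (subsetT I).
by have := rk_le_mrank N I; rewrite (rk_indep iI) cI -/(mrank M) -/(mrank N); lia.
Qed.

Lemma spanning_indepU1 J i : B J -> B (i |: J) = indep M (i |: J).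
Proof.
case/andP=> _ /eqP rJ; rewrite /B eqn_leq rk_le_mrank.
by rewrite -rJ rkS ?subsetUr ?andbT.
Qed.

Lemma spanning_indep_loop J i : i \in L -> B (i |: J) -> B J.
Proof.
rewrite inE => loop_i /andP[iiJ rJ]; apply/andP; split.
  by apply: indepS iiJ; exact: subsetUr.
by rewrite setUC rkU_loops // in rJ => x /set1P->.
Qed.

Lemma indep_card_spanning J : indep N J -> #|J| = r' -> B J.
Proof. by move=> iJ cJ; rewrite /B quot_indep // rk_indep // cJ /=. Qed.

Lemma spanning_card J : B J -> (r' <= #|J|)%N.
Proof. by case/andP=> _ /eqP<-; exact: rk_le_card. Qed.

Lemma spanning_card_indep J : B J -> (#|J| <= r')%N -> indep N J.
Proof. by case/andP=> _ /eqP rJ leJ; apply: indep_rk; rewrite rJ. Qed.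

Variable R : numFieldType.

Definition relation (a0 : R) (a : T -> R) : Prop :=
  forall J, (#|J| < r)%N ->
    a0 * (#|T| - #|J|)%:R * (B J)%:R + \sum_(i | (i \notin J) && B (i |: J)) a i = 0.

Hypothesis M_simple : simple_matroid M.

(** All bases of the morphism then have size r, so the derivative in x_0 of the reduced polynomial
    is zero. *)
Lemma relation_rank_eq : r = r' -> relation 1 (fun=> 0).
Proof.
move=> er J ltJ; rewrite big1 // addr0; case BJ: (B J); last by rewrite mulr0.
by have := spanning_card BJ; lia.
Qed.

(** A basis [J] of the morphism with fewer than r elements is a basis of [N], and J + l is again a
    basis of the morphism. The weight n - r' at [l] therefore balances the first term. If [J] is not
    a basis, neither is J + l. *)
Lemma relation_loop l : (r - r' = 1)%N -> l \in L ->
  relation (-1) (fun i => if i == l then (#|T| - r')%:R else 0).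
Proof.
move=> er Ll J ltJ; rewrite -big_mkcondr /=.
have [BJ|nBJ] := boolP (B J); last first.
  rewrite mulr0 add0r big1 // => i /andP[/andP[_ BiJ] /eqP ei].
  by rewrite ei in BiJ; rewrite (spanning_indep_loop Ll BiJ) in nBJ.
have cJ : #|J| = r' by have := spanning_card BJ; lia.
have iJ : indep N J by apply: spanning_card_indep; rewrite ?cJ.
have nJl : l \notin J by apply: contraL Ll => /(indep_loopN iJ); rewrite inE.
rewrite (big_pred1 l) => [|i].
  by rewrite cJ mulr1 mulN1r addNr.
rewrite /= andbC; have [->|//] := eqVneq i l; rewrite nJl spanning_indepU1 // setUC.
rewrite indep_setU_loops ?sub1set //; have [loopM _] := M_simple.
by have := loopM l; rewrite negbK.
Qed.

(** The complement of [L] is the only basis of [N], hence lies in every basis [J] of the morphism.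
    If |J| < r, uniformity lets every element outside [J] be added; these n - |J| elements are loops
    of weight 1. *)
Lemma relation_uniform : uniform_matroid (restrict M L) -> #|~: L| = r' ->
  relation (-1) (fun i => (i \in L)%:R).
Proof.
move=> /uniform_restrictP[s les indepE] cK J ltJ.
have [W [iW _ cW]] := rk_witness N [set: T]; rewrite -/(mrank N) -cK in cW.
have subK W' : indep N W' -> W' \subset ~: L.
  move=> iW'; apply/subsetP=> x W'x; rewrite !inE; exact: indep_loopN W'x.
have iK : indep N (~: L).
  by have /eqP<- : W == ~: L by rewrite eqEcard subK ?cW ?leqnn.
have spanK J' : B J' -> ~: L \subset J'.
  case/andP=> _ /eqP rJ'; have [W' [iW' sW' cW']] := rk_witness N J'.
  by have /eqP<- : W' == ~: L by rewrite eqEcard subK // cK cW' rJ' leqnn.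
(* A basis of [M] has at most r' elements outside [L], so at least r - r' independent elements
   inside it. *)
have ltrs : (r - r' <= s)%N.
  have [I [iI _ cI]] := rk_witness M [set: T]; rewrite -/(mrank M) in cI.
  have : indep M (I :&: L) by apply: indepS iI; exact: subsetIl.
  rewrite indepE ?subsetIr // => leI; have := cardsID L I.
  have : (#|I :\: L| <= r')%N by rewrite -cK subset_leq_card // setDE subsetIr.
  by lia.
have [BJ|nBJ] := boolP (B J); last first.
  rewrite mulr0 add0r big1 // => i /andP[nJi BiJ].
  by case Li: (i \in L) => //; rewrite (spanning_indep_loop Li BiJ) in nBJ.
have sKJ := spanK J BJ.
rewrite (eq_bigl (fun i => i \in ~: J)) => [|i]; last first.
  rewrite in_setC; have [//|nJi] /= := boolP (i \in J).
  have Li : i \in L by apply: contraR nJi => nLi; apply: (subsetP sKJ); rewrite inE.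
  rewrite spanning_indepU1 //.
  (* An N-independent part and a part made of loops, as [indep_setU_loops] requires. *)
  have -> : i |: J = ~: L :|: (i |: (J :&: L)).
    by rewrite setUCA setUIr [~: L :|: L]setUC setUCr setIT (setUidPr sKJ).
  have sL : i |: J :&: L \subset L by rewrite subUset sub1set Li subsetIr.
  rewrite indep_setU_loops // indepE // cardsU1 !inE (negPf nJi) /=.
  have := cardsID L J; have : J :\: L = ~: L by rewrite setDE; apply/setIidPr.
  by move=> ->; lia.
rewrite (eq_bigr (fun=> 1)) => [|i]; last first.
  rewrite in_setC => nJi; suff -> : i \in L by [].
  by apply: contraR nJi => nLi; apply: (subsetP sKJ); rewrite inE.
by rewrite sumr_const mulr1 mulN1r -(cardsC J) addKn addNr.
Qed.

(** * Consequences of a normalised relation in corank one and in corank at least two *)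

Section Necessity.
Variable a : T -> R.
Local Notation outM J := (\sum_(i in extensions M J) a i).
Local Notation outN J := (\sum_(i in extensions N J) a i).
Hypothesis outN0 : forall J, indep N J -> outN J = 0.
Hypothesis outME : forall J, B J -> (#|J| < r)%N -> outM J = (#|T| - #|J|)%:R.

(** Two loops would be independent in [M] by simplicity and would extend a basis of [N] to r' + 2 >
    r independent elements. With no loops, [outM] and [outN] agree at the empty set, where their
    values are n - r' > 0 and 0. *)
Lemma corank1_loops : (r - r' = 1)%N -> #|L| = 1%N.
Proof.
move=> er; apply/eqP; rewrite eqn_leq; apply/andP; split.
  rewrite leqNgt; apply/negP=> /card_gt1P[x [y [Lx Ly nexy]]].
  have [W [iW _ cW]] := rk_witness N [set: T]; rewrite -/(mrank N) in cW.
  have ixy : indep M [set x; y].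
    have [loopM parM] := M_simple; have := parM x y.
    by rewrite /is_parallel nexy !loopM negbK.
  have sxy : [set x; y] \subset L by rewrite subUset !sub1set Lx.
  have dWxy : [disjoint W & [set x; y]].
    by apply: (indep_disjoint_loops iW) => z /(subsetP sxy); rewrite inE.
  have := card_indep_le (indep_setU_loops sxy iW ixy).
  by rewrite cardsU (disjoint_setI0 dWxy) cards0 cards2 nexy; lia.
rewrite lt0n cards_eq0; apply/negP=> /eqP L0.
have outMc J : indep N J -> outM J = (#|T| - r')%:R.
  have [k] := ubnP (r' - #|J|)%N; elim: k J => // k IHk J ltk iJ.
  have leJ := card_indep_le iJ.
  have [eJ|neJ] := eqVneq #|J| r'.
    by rewrite outME ?eJ //; [exact: indep_card_spanning|lia].
  have [|i Ji] := extensions_neq0 iJ; first by lia.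
  have sNM : extensions N J \subset extensions M J.
    by apply/subsetP=> j; rewrite !inE => /andP[-> /quot_indep].
  (* If [j] were in the N-closure of [J], adding i' to J + j would raise the N-rank, hence also the
     M-rank, and [j] would not be parallel to i' over [J]. *)
  have clsS i' : i' \in extensions N J -> ext_class M J i' \subset extensions N J.
    move=> Ji'; apply/subsetP=> j /setDP[Jj nij].
    apply: contraR nij => nJj; rewrite (mem_ext2 _ (subsetP sNM _ Ji')).
    have nej : j != i' by apply: contraNneq nJj => ->.
    have nJ'j : j \notin J by move: Jj; rewrite inE => /andP[].
    rewrite nej nJ'j /= setUCA; apply: indep_rk.
    have := quot_rk (subsetUr [set i'] (j |: J)).
    rewrite (rk_indep (indep_ext Jj)) (card_ext Jj).
    have : (#|i' |: J| <= rk N (i' |: (j |: J)))%N.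
      by apply: card_le_rk (indep_ext Ji') _; rewrite setUS ?subsetUr.
    rewrite (card_ext Ji').
    have : (rk N (j |: J) <= #|J|)%N.
      rewrite leqNgt; apply: contra nJj => ltrk; rewrite inE nJ'j /=.
      by apply: indep_rk; rewrite (card_ext Jj).
    have -> : #|i' |: (j |: J)| = #|J|.+2.
      rewrite cardsU1 (card_ext Jj) !inE negb_or eq_sym nej /=.
      by move: Ji'; rewrite inE => /andP[->].
    by lia.
  have clsE i' : i' \in extensions N J ->
      \sum_(j in ext_class M J i') a j = outM J - (#|T| - r')%:R.
    move=> Ji'; rewrite sum_ext_class ?(subsetP sNM) // [X in _ - X]IHk //.
      by rewrite (card_ext Ji'); lia.
    exact: indep_ext Ji'.
  (* [outN J], which is 0, is a positive multiple of [outM J] - (n - r'). *)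
  have /esym/eqP := sum_ext_classes sNM clsS clsE.
  rewrite outN0 // mulrn_eq0 cards_eq0 subr_eq0 => /orP[/eqP cls0|/eqP//].
  by have := imset_f (ext_class M J) Ji; rewrite cls0 inE.
have := outMc _ (indep0 N); rewrite (eq_bigl (mem (extensions N set0))) => [|i].
  rewrite outN0 ?indep0 // => /esym/eqP; rewrite pnatr_eq0.
  have [I [_ _ cI]] := rk_witness M [set: T]; rewrite -/(mrank M) in cI.
  have : (#|I| <= #|T|)%N by exact: max_card.
  by lia.
have [loopM _] := M_simple; have := loopM i; rewrite !inE !setU0 negbK => ->.
by have := in_set0 i; rewrite -L0 inE => /negbT; rewrite negbK => ->.
Qed.

(** Each class sums to (n - |J|) - (n - |J| - 1) = 1, so there are n - |J| classes. Only n - |J|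
    elements lie outside [J], so all of them are extensions and each class is a singleton. *)
Lemma spanning_extensions J : B J -> (#|J|.+2 <= r)%N ->
  [/\ extensions M J = ~: J, forall i, i \notin J -> a i = 1
    & forall i j, i \notin J -> j \notin J -> i != j -> indep M (j |: (i |: J))].
Proof.
move=> BJ ltJ.
have clsS i : i \in extensions M J -> ext_class M J i \subset extensions M J.
  by move=> _; rewrite subDset subsetUr.
have clsE i : i \in extensions M J -> \sum_(j in ext_class M J i) a j = 1.
  move=> Ji; have BiJ : B (i |: J) by rewrite spanning_indepU1 //; exact: indep_ext Ji.
  have ltJT : (#|i |: J| <= #|T|)%N by exact: max_card.
  rewrite (card_ext Ji) in ltJT.
  rewrite sum_ext_class // (outME BJ (ltnW ltJ)) (outME BiJ) (card_ext Ji) //.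
  by rewrite -natrB ?leq_sub2l // (_ : (#|T| - #|J| - _)%N = 1%N) //; lia.
have := sum_ext_classes (subxx _) clsS clsE; rewrite outME //; last by lia.
move/eqP; rewrite eqr_nat => /eqP ct.
have sJC : extensions M J \subset ~: J.
  by apply/subsetP=> i; rewrite !inE => /andP[].
have le1 := leq_imset_card (ext_class M J) (extensions M J).
have le2 := subset_leq_card sJC; have eC := cardsC J.
have eJC : extensions M J = ~: J.
  by apply/eqP; rewrite eqEcard sJC; lia.
have /imset_injP inj : #|ext_class M J @: extensions M J| == #|extensions M J| by lia.
have mem_cls i j : i \notin J -> j \notin J -> (j \in ext_class M J i) = (j == i).
  move=> nJi nJj; have Ji : i \in extensions M J by rewrite eJC inE.
  have Jj : j \in extensions M J by rewrite eJC inE.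
  by rewrite -eq_ext_class // (inj_in_eq inj).
split=> // [i nJi|i j nJi nJj neij].
  have Ji : i \in extensions M J by rewrite eJC inE.
  rewrite -(clsE i Ji) (big_pred1 i) // => j /=.
  have [Jj|nJj] := boolP (j \in J); last exact: mem_cls.
  rewrite in_setD eJC in_setC Jj andbF; apply/esym/negbTE.
  by apply: contraNneq nJi => <-.
have Ji : i \in extensions M J by rewrite eJC inE.
have := mem_cls i j nJi nJj; rewrite eq_sym (negPf neij) in_setD eJC in_setC nJj andbT.
by move=> /negbFE/indep_ext.
Qed.

(** The weight is 1 outside each basis of [N] and 0 on the fixed basis [W]. Then [outN] at the empty
    set counts the non-loops outside [W], so there are none. The rank of the uniform restriction is
    r - r'. *)
Lemma corank2_uniform : (r'.+2 <= r)%N ->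
  uniform_matroid (restrict M L) /\ #|~: L| = r'.
Proof.
move=> ltr; have [W [iW _ cW]] := rk_witness N [set: T]; rewrite -/(mrank N) in cW.
have sWL : W \subset ~: L.
  by apply/subsetP=> x Wx; rewrite !inE; exact: indep_loopN Wx.
have a1 W' : indep N W' -> #|W'| = r' -> forall i, i \notin W' -> a i = 1.
  move=> iW' cW'; have [|//] := spanning_extensions (indep_card_spanning iW' cW').
  by rewrite cW'.
have a0 j : j \in W -> a j = 0.
  move=> Wj; have iWj : indep N (W :\ j) by apply: indepS iW; exact: subsetDl.
  have Wjj : j \in extensions N (W :\ j) by rewrite !inE eqxx setD1K.
  have := outN0 iWj; rewrite (big_setD1 j) //=.
  rewrite (eq_bigr (fun=> 1)) => [|i]; last first.
    rewrite !inE => /and3P[neij nWi _]; apply: (a1 W) => //.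
    by move: nWi; rewrite neij.
  rewrite sumr_const; case: (set_0Vmem (extensions N (W :\ j) :\ j)) => [->|[i]].
    by rewrite cards0 addr0.
  move=> Xi; have [neij WJi] := setD1P Xi.
  (* Exchanging [j] for [i] gives a basis of [N] avoiding [j], so [a j] would be 1 and a sum of ones
     would vanish. *)
  rewrite (a1 (i |: W :\ j)) ?(indep_ext WJi) //.
  - by rewrite -mulrS => /eqP; rewrite pnatr_eq0.
  - by rewrite (card_ext WJi) -cW (cardsD1 j W) Wj.
  - by rewrite !inE eq_sym (negPf neij) eqxx.
have eWL : ~: L = W.
  apply/eqP; rewrite eqEsubset sWL andbT -setD_eq0 -cards_eq0.
  have := outN0 (indep0 N); rewrite (eq_bigl (mem (~: L))) => [|i]; last first.
    by rewrite !inE setU0 negbK.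
  rewrite (big_setID W) /= big1 => [|i /setIP[_ /a0//]].
  rewrite (eq_bigr (fun=> 1)) => [|i /setDP[_]]; last exact: a1.
  by rewrite sumr_const add0r => /eqP; rewrite pnatr_eq0.
split; last by rewrite eWL.
have cL : (r - r' <= #|L|)%N.
  have [I [_ _ cI]] := rk_witness M [set: T]; rewrite -/(mrank M) in cI.
  have : (#|I| <= #|T|)%N by exact: max_card.
  by have := cardsC L; rewrite eWL; lia.
apply/uniform_restrictP; exists (r - r')%N => // A sAL.
have cardWU A' : A' \subset L -> #|W :|: A'| = (r' + #|A'|)%N.
  move=> sA'L; have dWA' : [disjoint W & A'].
    by apply: (indep_disjoint_loops iW) => x /(subsetP sA'L); rewrite inE.
  by rewrite cardsU (disjoint_setI0 dWA') cards0 cW; lia.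
apply/idP/idP=> [iA|leA].
  by have := card_indep_le (indep_setU_loops sAL iW iA); rewrite cardWU //; lia.
suff : indep M (W :|: A) by apply: indepS; exact: subsetUr.
have nWL x : x \in L -> x \notin W by rewrite -eWL in_setC negbK.
(* Induction removing two elements [i] and [j]: what remains, together with [W], is a basis of the
   morphism of size at most r - 2, to which [spanning_extensions] adds both. *)
have [k] := ubnP #|A|; elim: k A sAL leA => // k IHk A sAL leA ltA.
have [->|[i Ai]] := set_0Vmem A; first by rewrite setU0 quot_indep.
have cA := cardsD1 i A; rewrite Ai in cA.
have Li := subsetP sAL i Ai.
have [A0|[j Aj]] := set_0Vmem (A :\ i).
  have [|eW _ _] := spanning_extensions (indep_card_spanning iW cW); first by rewrite cW.
  rewrite -(setD1K Ai) A0 setU0 setUC; apply: indep_ext.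
  by rewrite eW inE nWL.
have cAi := cardsD1 j (A :\ i); rewrite Aj in cAi.
have Lj : j \in L by apply: (subsetP sAL); case/setD1P: Aj.
have sL : A :\ i :\ j \subset L.
  exact: subset_trans (subsetDl _ _) (subset_trans (subsetDl _ _) sAL).
have BW : B (W :|: (A :\ i :\ j)).
  rewrite /B IHk //; [|by lia..].
  by rewrite rkU_loops ?rk_indep ?cW ?eqxx // => x /(subsetP sL); rewrite inE.
have [|_ _ ind] := spanning_extensions BW; first by rewrite cardWU //; lia.
have [neji _] := setD1P Aj.
have -> : W :|: A = j |: (i |: (W :|: (A :\ i :\ j))).
  by rewrite !(setUCA _ W) (setUCA [set j]) (setD1K Aj) (setD1K Ai).
apply: ind; rewrite ?(eq_sym i) // in_setU negb_or nWL //=.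
  by rewrite !in_setD1 eqxx andbF.
by rewrite in_setD1 eqxx.
Qed.

End Necessity.

(** Dividing by -a_0 produces [b]; the point is that a_0 cannot vanish when the relation is
    nontrivial. *)
Lemma relation_nonzero a0 a : (r' < r)%N -> relation a0 a ->
    (a0 != 0 \/ exists i, a i != 0) ->
  exists b : T -> R,
    (forall J, indep N J -> \sum_(i in extensions N J) b i = 0) /\
    (forall J, B J -> (#|J| < r)%N ->
      \sum_(i in extensions M J) b i = (#|T| - #|J|)%:R).
Proof.
move=> ltr rel nz.
(* At |J| = r' - 1 the first term is absent, and the sets J + i that are bases of the morphism are
   the N-independent ones. *)
have outN0 : forall J, indep N J -> \sum_(i in extensions N J) a i = 0.
  apply: sum_extensions_eq0 => J iJ cJ.
  have := rel J; rewrite (_ : (#|J| < r)%N); last by lia.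
  have -> : B J = false.
    by apply/negP=> /spanning_card; lia.
  rewrite mulr0 add0r => sum0; rewrite -[RHS]sum0 //; apply: eq_bigl => i; rewrite inE.
  have [//|nJi] /= := boolP (i \in J).
  have ciJ : #|i |: J| = r' by rewrite cardsU1 nJi.
  apply/idP/idP=> [iiJ|BiJ]; first exact: indep_card_spanning.
  by apply: (spanning_card_indep BiJ); rewrite ciJ.
(* If a_0 = 0, the relations at |J| = r - 1 start the same induction in [M], whose simplicity then
   kills every weight. *)
have a0_neq0 : a0 != 0.
  apply/eqP=> a00; case: nz => [|[i]]; rewrite ?a00 ?eqxx // => /eqP[].
  apply: (@simple_sum_extensions_eq0 _ M) => //.
  apply: sum_extensions_eq0 => J iJ cJ.
  have := rel J; rewrite -cJ a00 !mul0r add0r => sum0; rewrite -[RHS]sum0 //.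
  apply: eq_bigl => j; rewrite inE; have [//|nJj] /= := boolP (j \in J).
  apply/idP/idP=> [ijJ|/andP[]//]; apply: spanning_indep_basis => //.
  by rewrite cardsU1 nJj -cJ.
exists (fun i => - a i / a0); split=> J => [iJ|BJ ltJ].
  by rewrite -mulr_suml sumrN outN0 // oppr0 mul0r.
rewrite -mulr_suml sumrN; apply: (canLR (mulfK a0_neq0)).
apply/eqP; rewrite eq_sym -addr_eq0 mulrC; apply/eqP.
rewrite -[RHS](rel J ltJ) BJ mulr1; congr (_ + _); apply: eq_bigl => i; rewrite inE.
by rewrite spanning_indepU1.
Qed.

Lemma relationP :
  (exists a0 a, (a0 != 0 \/ exists i, a i != 0) /\ relation a0 a) <->
  [\/ r = r', (r - r' = 1)%N /\ #|L| = 1%N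
    | uniform_matroid (restrict M L) /\ #|~: L| = r'].
Proof.
split=> [[a0 [a [nz rel]]]|[er|[er cL]|[unif cL]]].
- have [er|ner] := eqVneq r r'; first by constructor 1.
  have ltr : (r' < r)%N by have := quot_mrank; lia.
  have [b [outN0 outME]] := relation_nonzero ltr rel nz.
  have [er|ner1] := eqVneq (r - r')%N 1%N.
    by constructor 2; split=> //; exact: corank1_loops outN0 outME er.
  by constructor 3; apply: corank2_uniform outN0 outME _; lia.
- exists 1, (fun=> 0); split; last exact: relation_rank_eq.
  by left; rewrite oner_eq0.
- have /card_gt0P[l Ll] : (0 < #|L|)%N by rewrite cL.
  exists (-1), (fun i => if i == l then (#|T| - r')%:R else 0); split.
    by left; rewrite oppr_eq0 oner_eq0.
  exact: relation_loop.
- exists (-1), (fun i => (i \in L)%:R); split; last exact: relation_uniform.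
  by left; rewrite oppr_eq0 oner_eq0.
Qed.

End Quotient.

Theorem theorem5p6 (R : realType) (n r r' : nat) (E : finType)
    (M : matroid 'I_n) (N : matroid E) (phi : 'I_n -> E)
    (M_simple : simple_matroid M) (rank_M : mrank M = r) (rank_N : mrank N = r')
    (phi_morph : matroid_morphism M N phi)
    (phi_full : rk N (phi @: [set: 'I_n]) = r') :
  lin_dependent
    (fun i : 'I_n.+1 => (reduced_basis_gen_poly R M N phi)^`M(i)) <->
  [\/ r = r',
      (r - r' = 1)%N /\ #|morphism_loops N phi| = 1%N |
      uniform_matroid (restrict M (morphism_loops N phi)) /\
      #|~: morphism_loops N phi| = r' ].
Proof.
(* The pullback turns [phi] into the identity and preserves loops and bases of the morphism; its
   rank is r' by [phi_full]. *)
pose N' := comap N phi.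
have quotMN' : matroid_morphism M N' id.
  by move=> S1 S2 sS; rewrite !imset_id !rk_comap; exact: phi_morph.
have rank_N' : mrank N' = r' by rewrite /mrank rk_comap.
have loopsE : morphism_loops N phi = [set i | is_loop N' i].
  by apply/setP=> i; rewrite !inE is_loop_comap.
have basesE J : (J \in morphism_bases M N phi) = spanning_indep M N' J.
  by rewrite inE /spanning_indep rk_comap rank_N rank_N'.
have := relationP quotMN' R M_simple; rewrite rank_N' rank_M -loopsE => <-.
rewrite lin_dependentP; split=> -[a0 [a [nz rel]]]; exists a0, a; split=> // J ltJ.
  rewrite -[RHS](rel J ltJ) basesE card_ord; congr (_ + _).
  by apply: eq_bigl => i; rewrite basesE.
rewrite -[RHS](rel J ltJ) basesE card_ord; congr (_ + _).
by apply: eq_bigl => i; rewrite basesE.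
Qed.
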